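(* Let $r$ and $s$ be integers. Then \[ \sum_{j = 0}^\infty \frac{2^{2j + 1}}{2j + 1}\,\frac{1}{\binom{2j}j}\,\frac{F_{2rj + s}}{L_{2r}^{j + 1}} = \frac{\pi }{2}F_s + \frac{L_s}{\sqrt 5 }\arctan \left( \frac{F_{2r} \sqrt 5 }{2} \right), \qquad \sum_{j = 0}^\infty \frac{2^{2j + 1}}{2j + 1}\,\frac{1}{\binom{2j}j}\,\frac{L_{2rj + s}}{L_{2r}^{j + 1}} = \frac{\pi }{2}L_s + F_s \sqrt 5 \arctan \left( \frac{F_{2r} \sqrt 5 }{2} \right). \]
   Context: $F_j$ and $L_j$ denote the Fibonacci and Lucas numbers, defined for all integers $j$ by $F_0=0$, $F_1=1$, $L_0=2$, $L_1=1$, $F_j=F_{j-1}+F_{j-2}$, $L_j=L_{j-1}+L_{j-2}$, extended to negative indices by $F_{-j}=(-1)^{j-1}F_j$, $L_{-j}=(-1)^jL_j$; equivalently $F_j=(\alpha^j-\beta^j)/\sqrt5$, $L_j=\alpha^j+\beta^j$ with $\alpha=(1+\sqrt5)/2$, $\beta=(1-\sqrt5)/2$. *)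

(* Defs.v *)
From Stdlib Require Import ZArith Lia.
Local Open Scope Z_scope.

Fixpoint fib_nat (n : nat) : Z :=
  match n with
  | O => 0
  | S m => match m with O => 1 | S k => fib_nat m + fib_nat k end
  end.

Fixpoint lucas_nat (n : nat) : Z :=
  match n with
  | O => 2
  | S m => match m with O => 1 | S k => lucas_nat m + lucas_nat k end
  end.

Definition fib (j : Z) : Z :=
  match j with
  | Z0 => fib_nat 0
  | Zpos p => fib_nat (Pos.to_nat p)
  | Zneg p => (-1) ^ (Zpos p - 1) * fib_nat (Pos.to_nat p)
  end.

Definition lucas (j : Z) : Z :=
  match j with
  | Z0 => lucas_nat 0
  | Zpos p => lucas_nat (Pos.to_nat p)
  | Zneg p => (-1) ^ (Zpos p) * lucas_nat (Pos.to_nat p)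
  end.

Lemma fib_of_nat (n : nat) : fib (Z.of_nat n) = fib_nat n.
Proof. destruct n; [reflexivity|]; simpl Z.of_nat; unfold fib; now rewrite SuccNat2Pos.id_succ. Qed.

Lemma lucas_of_nat (n : nat) : lucas (Z.of_nat n) = lucas_nat n.
Proof. destruct n; [reflexivity|]; simpl Z.of_nat; unfold lucas; now rewrite SuccNat2Pos.id_succ. Qed.

Lemma fib_opp_of_nat (n : nat) :
  fib (- Z.of_nat (S n)) = (-1) ^ Z.of_nat n * fib_nat (S n).
Proof.
  simpl Z.of_nat; unfold fib, Z.opp; rewrite SuccNat2Pos.id_succ.
  do 2 f_equal; lia.
Qed.

Lemma lucas_opp_of_nat (n : nat) :
  lucas (- Z.of_nat n) = (-1) ^ Z.of_nat n * lucas_nat n.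
Proof.
  destruct n; [reflexivity|].
  simpl Z.of_nat; unfold lucas, Z.opp; now rewrite SuccNat2Pos.id_succ.
Qed.

Lemma fib_rec (j : Z) : fib j = fib (j - 1) + fib (j - 2).
Proof.
  destruct (Z_le_gt_dec 2 j) as [H|H].
  - destruct (Z_of_nat_complete (j - 2)) as [n Hn]; [lia|].
    replace j with (Z.of_nat (S (S n))) by lia.
    replace (Z.of_nat (S (S n)) - 1) with (Z.of_nat (S n)) by lia.
    replace (Z.of_nat (S (S n)) - 2) with (Z.of_nat n) by lia.
    now rewrite !fib_of_nat.
  - destruct (Z.eq_dec j 1) as [->|Hj]; [reflexivity|].
    destruct (Z.eq_dec j 0) as [->|Hj']; [reflexivity|].
    destruct (Z_of_nat_complete (- j - 1)) as [n Hn]; [lia|].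
    replace (j - 1) with (- Z.of_nat (S (S n))) by lia.
    replace (j - 2) with (- Z.of_nat (S (S (S n)))) by lia.
    replace j with (- Z.of_nat (S n)) by lia.
    rewrite !fib_opp_of_nat, !Nat2Z.inj_succ, !Z.pow_succ_r by lia.
    change (fib_nat (S (S (S n)))) with (fib_nat (S (S n)) + fib_nat (S n)); ring.
Qed.

Lemma lucas_rec (j : Z) : lucas j = lucas (j - 1) + lucas (j - 2).
Proof.
  destruct (Z_le_gt_dec 2 j) as [H|H].
  - destruct (Z_of_nat_complete (j - 2)) as [n Hn]; [lia|].
    replace j with (Z.of_nat (S (S n))) by lia.
    replace (Z.of_nat (S (S n)) - 1) with (Z.of_nat (S n)) by lia.
    replace (Z.of_nat (S (S n)) - 2) with (Z.of_nat n) by lia.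
    now rewrite !lucas_of_nat.
  - destruct (Z.eq_dec j 1) as [->|Hj]; [reflexivity|].
    destruct (Z_of_nat_complete (- j)) as [n Hn]; [lia|].
    replace (j - 1) with (- Z.of_nat (S n)) by lia.
    replace (j - 2) with (- Z.of_nat (S (S n))) by lia.
    replace j with (- Z.of_nat n) by lia.
    rewrite !lucas_opp_of_nat, !Nat2Z.inj_succ, !Z.pow_succ_r by lia.
    change (lucas_nat (S (S n))) with (lucas_nat (S n) + lucas_nat n); ring.
Qed.

(* Main.v *)
Require Import Defs.
From Stdlib Require Import ZArith Reals.
From Coquelicot Require Import Coquelicot.
From Stdlib Require Import Lra Lia.
Open Scope R_scope.

(** By Binet's formulas both sums are combinations of Euler's arctangent series
    [atan a = sum_j 4^j / ((2j+1) C(2j,j)) * a^(2j+1) / (1+a^2)^(j+1)]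
    at [a = alpha^(2r)] and at [a = beta^(2r) = 1 / alpha^(2r)].  The values are
    combined through [atan a + atan (1/a) = PI/2] and
    [atan a - atan (1/a) = atan ((a - 1/a) / 2)].
    Euler's series is proved by differentiating its partial sums: the derivatives
    telescope, which bounds the remainder by [a * e_n * (a^2/(1+a^2))^n], where
    [e_n = 4^n / C(2n,n)]. *)

(** * Euler's series for the arctangent *)

Definition central_ratio (n : nat) : R := 4 ^ n / Binomial.C (2 * n) n.

Lemma central_binomial_pos (n : nat) : 0 < Binomial.C (2 * n) n.
Proof.
  unfold Binomial.C, Rdiv; apply Rmult_lt_0_compat; [apply INR_fact_lt_0|].
  apply Rinv_0_lt_compat, Rmult_lt_0_compat; apply INR_fact_lt_0.
Qed.

Lemma central_binomial_S (n : nat) :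
  Binomial.C (2 * S n) (S n) =
  Binomial.C (2 * n) n * (2 * (2 * INR n + 1) / (INR n + 1)).
Proof.
  unfold Binomial.C.
  replace (2 * S n - S n)%nat with (S n) by lia.
  replace (2 * n - n)%nat with n by lia.
  replace (2 * S n)%nat with (S (S (2 * n))) by lia.
  rewrite !fact_simpl, !mult_INR, !S_INR, mult_INR.
  pose proof (INR_fact_neq_0 n); pose proof (pos_INR n).
  change (INR 2) with 2.
  field; split; lra.
Qed.

Lemma central_ratio_0 : central_ratio 0 = 1.
Proof. unfold central_ratio, Binomial.C; simpl; field. Qed.

Lemma central_ratio_S (n : nat) :
  central_ratio (S n) = central_ratio n * ((2 * INR n + 2) / (2 * INR n + 1)).
Proof.
  unfold central_ratio; rewrite central_binomial_S.
  pose proof (central_binomial_pos n); pose proof (pos_INR n).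
  simpl pow; field; repeat split; lra.
Qed.

Lemma central_ratio_pos (n : nat) : 0 < central_ratio n.
Proof.
  apply Rdiv_lt_0_compat; [apply pow_lt; lra | apply central_binomial_pos].
Qed.

(** Ratio test: consecutive terms have quotient [x + x / (2n+1)], which tends to [x < 1], so the
    terms are summable and hence vanish. This makes the remainder bound tend to 0. *)
Lemma central_ratio_geom_lim (x : R) :
  0 < x < 1 -> is_lim_seq (fun n => central_ratio n * x ^ n) 0.
Proof.
  intros Hx; apply ex_series_lim_0.
  apply ex_series_Rabs, ex_series_DAlembert with x; [lra | |].
  - intros n; apply Rgt_not_eq, Rmult_lt_0_compat;
      [apply central_ratio_pos | apply pow_lt; lra].
  - apply is_lim_seq_ext with (fun n => x + x * / (2 * INR n + 1)).
    + intros n.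
      pose proof (central_ratio_pos n); pose proof (pos_INR n).
      assert (0 < x ^ n) by (apply pow_lt; lra).
      rewrite central_ratio_S, <- tech_pow_Rmult.
      replace (_ / _) with (x + x * / (2 * INR n + 1)) by (field; lra).
      symmetry; apply Rabs_pos_eq.
      assert (0 < / (2 * INR n + 1)) by (apply Rinv_0_lt_compat; lra).
      nra.
    + replace (Finite x) with (Finite (x + x * 0)) by (f_equal; ring).
      apply is_lim_seq_plus'; [apply is_lim_seq_const|].
      apply is_lim_seq_mult'; [apply is_lim_seq_const|].
      (* The limit 0 is read as the inverse of the limit of [2n+1], which dominates [n]. *)
      change (Finite 0) with (Rbar_inv p_infty).
      apply is_lim_seq_inv; [|discriminate].
      apply is_lim_seq_le_p_loc with INR; [|apply is_lim_seq_INR].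
      exists 0%nat; intros n _; pose proof (pos_INR n); lra.
Qed.

Definition euler_atan_term (a : R) (j : nat) : R :=
  central_ratio j / (2 * INR j + 1) * (a * (a ^ 2) ^ j / (1 + a ^ 2) ^ (j + 1)).

(** With [x = a^2 / (1+a^2)], the derivative of [a^(2j+1) / (1+a^2)^(j+1)] is
    [x^j ((2j+1) - (2j+2) x) / (1+a^2)]. The coefficient divides this by [2j+1], and
    [central_ratio_S] absorbs the quotient [(2j+2)/(2j+1)], leaving a difference of consecutive
    terms. *)
Lemma is_derive_euler_atan_term (j : nat) (a : R) :
  is_derive (fun a => euler_atan_term a j) a
    (/ (1 + a ^ 2) * (central_ratio j * (a ^ 2 / (1 + a ^ 2)) ^ j -
       central_ratio (S j) * (a ^ 2 / (1 + a ^ 2)) ^ S j)).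
Proof.
  unfold euler_atan_term.
  assert (Ha : 0 < 1 + a ^ 2) by nra.
  pose proof (pos_INR j).
  apply is_derive_ext with (fun a => central_ratio j / (2 * INR j + 1) *
    (a ^ (2 * j + 1) / (1 + a ^ 2) ^ (j + 1))).
  { intros t; rewrite <- pow_mult, (pow_add t), pow_1, (Rmult_comm t); reflexivity. }
  auto_derive.
  { apply Rgt_not_eq, pow_lt; nra. }
  replace (a * (a * 1)) with (a ^ 2) by ring.
  replace (Nat.pred (j + 1)) with j by lia.
  replace (Nat.pred (j + (j + 0) + 1)) with (2 * j)%nat by lia.
  replace (j + (j + 0) + 1)%nat with (2 * j + 1)%nat by lia.
  rewrite central_ratio_S, !plus_INR, mult_INR.
  unfold Rdiv; rewrite !Rpow_mult_distr, !pow_inv.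
  rewrite !pow_add, !pow_mult, !pow_1, <- !(tech_pow_Rmult _ j).
  assert (0 < (1 + a ^ 2) ^ j) by (apply pow_lt; nra).
  change (INR 2) with 2; change (INR 1) with 1.
  set (u := (1 + a ^ 2) ^ j) in *; set (v := (a ^ 2) ^ j).
  field; repeat split; nra.
Qed.

(** The derivatives of the terms telescope. Their first piece is [/ (1 + a ^ 2)] because
    [central_ratio 0 = 1], and it cancels the derivative of [atan]; only the last piece survives. *)
Lemma is_derive_atan_minus_euler_sum (n : nat) (a : R) :
  is_derive (fun a => atan a - sum_n (euler_atan_term a) n) a
    (/ (1 + a ^ 2) * (central_ratio (S n) * (a ^ 2 / (1 + a ^ 2)) ^ S n)).
Proof.
  assert (Hatan : is_derive atan a (/ (1 + a ^ 2))).
  { rewrite is_derive_Reals; apply derivable_pt_lim_atan. }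
  induction n as [|n IH].
  - apply is_derive_ext with (fun a => atan a - euler_atan_term a 0).
    { intros t; now rewrite sum_O. }
    replace (/ (1 + a ^ 2) * _) with
      (/ (1 + a ^ 2) - / (1 + a ^ 2) * (central_ratio 0 * (a ^ 2 / (1 + a ^ 2)) ^ 0 -
        central_ratio 1 * (a ^ 2 / (1 + a ^ 2)) ^ 1)).
    2: { rewrite central_ratio_0; ring. }
    apply (is_derive_minus atan _ _ _ _ Hatan), is_derive_euler_atan_term.
  - apply is_derive_ext with
      (fun a => (atan a - sum_n (euler_atan_term a) n) - euler_atan_term a (S n)).
    { intros t; rewrite sum_Sn; unfold plus; simpl; ring. }
    pose proof (is_derive_minus _ _ _ _ _ IH
                  (is_derive_euler_atan_term (S n) a)) as H.
    replace (/ (1 + a ^ 2) * _) with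
      (minus (/ (1 + a ^ 2) * (central_ratio (S n) * (a ^ 2 / (1 + a ^ 2)) ^ S n))
        (/ (1 + a ^ 2) * (central_ratio (S n) * (a ^ 2 / (1 + a ^ 2)) ^ S n -
           central_ratio (S (S n)) * (a ^ 2 / (1 + a ^ 2)) ^ S (S n))));
      [exact H|].
    unfold minus, plus, opp; simpl; ring.
Qed.

Lemma euler_sum_0 (n : nat) : sum_n (euler_atan_term 0) n = 0.
Proof.
  assert (H : forall j, euler_atan_term 0 j = 0).
  { intros j; unfold euler_atan_term, Rdiv; ring. }
  induction n as [|n IH]; [now rewrite sum_O, H|].
  rewrite sum_Sn, IH, H; unfold plus; simpl; ring.
Qed.

(** Mean value theorem on [[0, a]]: the remainder vanishes at 0, so it equals [a] times its
    derivative at some [c]. That derivative is nonnegative and is bounded using [1/(1+c^2) <= 1] and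
    the monotonicity of [x^2/(1+x^2)] for [x >= 0]. *)
Lemma euler_atan_remainder (n : nat) (a : R) : 0 < a ->
  0 <= atan a - sum_n (euler_atan_term a) n <=
  a * (central_ratio (S n) * (a ^ 2 / (1 + a ^ 2)) ^ S n).
Proof.
  intros Ha.
  destruct (MVT_gen (fun a => atan a - sum_n (euler_atan_term a) n) 0 a
    (fun a => / (1 + a ^ 2) *
       (central_ratio (S n) * (a ^ 2 / (1 + a ^ 2)) ^ S n))) as [c [Hc E]].
  - intros; apply is_derive_atan_minus_euler_sum.
  - intros x _; apply continuity_pt_filterlim.
    apply (ex_derive_continuous (fun a => atan a - sum_n (euler_atan_term a) n)).
    eexists; apply is_derive_atan_minus_euler_sum.
  - rewrite Rmin_left, Rmax_right in Hc by lra.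
    rewrite euler_sum_0, atan_0, !Rminus_0_r in E.
    rewrite E.
    pose proof (central_ratio_pos (S n)) as Hr.
    assert (Hi : 0 < / (1 + c ^ 2) <= 1).
    { split; [apply Rinv_0_lt_compat; nra|].
      rewrite <- Rinv_1; apply Rinv_le_contravar; nra. }
    assert (Hx : 0 <= c ^ 2 / (1 + c ^ 2) <= a ^ 2 / (1 + a ^ 2)).
    { split; [apply Rmult_le_pos; nra|].
      apply Rmult_le_reg_r with ((1 + c ^ 2) * (1 + a ^ 2)); [nra|].
      field_simplify; nra. }
    pose proof (pow_le _ (S n) (proj1 Hx)) as H0.
    pose proof (pow_incr _ _ (S n) Hx) as H1.
    set (u := (c ^ 2 / (1 + c ^ 2)) ^ S n) in *.
    set (v := (a ^ 2 / (1 + a ^ 2)) ^ S n) in *.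
    assert (0 <= central_ratio (S n) * u <= central_ratio (S n) * v) by nra.
    split; [apply Rmult_le_pos; nra|].
    rewrite Rmult_comm; apply Rmult_le_compat_l; nra.
Qed.

Lemma is_series_euler_atan (a : R) :
  0 < a -> is_series (euler_atan_term a) (atan a).
Proof.
  intros Ha.
  change (is_lim_seq (sum_n (euler_atan_term a)) (atan a)).
  set (b := fun n : nat => a * (central_ratio (S n) * (a ^ 2 / (1 + a ^ 2)) ^ S n)).
  apply is_lim_seq_le_le with (fun n => atan a - b n) (fun _ => atan a).
  - intros n; pose proof (euler_atan_remainder n a Ha); unfold b; lra.
  - replace (Finite (atan a)) with (Finite (atan a - a * 0)) by (f_equal; ring).
    apply is_lim_seq_minus'; [apply is_lim_seq_const|].
    apply is_lim_seq_mult'; [apply is_lim_seq_const|].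
    (* The bound carries index [S n]; shifting the index leaves the limit unchanged. *)
    apply (is_lim_seq_incr_1 (fun n => central_ratio n * (a ^ 2 / (1 + a ^ 2)) ^ n)).
    apply central_ratio_geom_lim.
    assert (0 < a ^ 2) by nra.
    split; [apply Rdiv_lt_0_compat; lra|].
    apply Rmult_lt_reg_r with (1 + a ^ 2); [lra|].
    field_simplify; lra.
  - apply is_lim_seq_const.
Qed.

(** Dividing numerator and denominator by [a^(j+1)] gives a denominator invariant under [a -> 1/a].
    The series at [a] and at [/ a] can then be combined termwise. The factor 2 comes from
    [2^(2j+1) = 2 * 4^j]. *)
Lemma is_series_euler_atan_symmetric (a : R) : 0 < a ->
  is_series (fun j : nat => 2 ^ (2 * j + 1) / INR (2 * j + 1) *
      (1 / Binomial.C (2 * j) j) * (a ^ j / (a + / a) ^ (j + 1)))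
    (2 * atan a).
Proof.
  intros Ha.
  pose proof (is_series_scal 2 _ _ (is_series_euler_atan a Ha)) as H.
  revert H; apply is_series_ext; intros j.
  unfold scal; simpl; unfold mult; simpl; unfold euler_atan_term, central_ratio.
  replace (a + / a) with ((1 + a ^ 2) * / a) by (field; lra).
  replace (j + (j + 0))%nat with (2 * j)%nat by lia.
  rewrite plus_INR, mult_INR, Rpow_mult_distr, pow_inv, !pow_add, !pow_mult, !pow_1.
  replace (2 ^ 2) with 4 by ring.
  change (INR 2) with 2; change (INR 1) with 1.
  replace ((a ^ 2) ^ j) with (a ^ j * a ^ j) by (rewrite <- Rpow_mult_distr; f_equal; ring).
  pose proof (central_binomial_pos j); pose proof (pos_INR j).
  assert (0 < a ^ j) by (apply pow_lt; lra).
  assert (0 < (1 + a ^ 2) ^ j) by (apply pow_lt; nra).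
  assert (0 < 1 + a ^ 2) by nra.
  field; repeat split; nra.
Qed.

(** Both arctangents lie in [(0, PI/2)], so their difference lies where [atan] inverts [tan]. The
    subtraction formula for [tan] has denominator [1 + a * / a = 2]. *)
Lemma atan_minus_atan_inv (a : R) :
  0 < a -> atan a - atan (/ a) = atan ((a - / a) / 2).
Proof.
  intros Ha.
  pose proof (atan_bound a); pose proof (atan_bound (/ a)).
  pose proof (Rinv_0_lt_compat a Ha) as Hi.
  pose proof (atan_increasing 0 a Ha) as P1.
  pose proof (atan_increasing 0 _ Hi) as P2.
  rewrite atan_0 in P1, P2.
  rewrite <- (atan_tan (atan a - atan (/ a))) by lra.
  f_equal.
  assert (Hc : forall x, cos (atan x) <> 0).
  { intros x; pose proof (atan_bound x); apply Rgt_not_eq, cos_gt_0; lra. }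
  rewrite tan_minus.
  - rewrite !tan_atan; field; lra.
  - apply Hc.
  - apply Hc.
  - apply Rgt_not_eq, cos_gt_0; lra.
  - rewrite !tan_atan, Rinv_r by lra; lra.
Qed.

(** * Binet's formulas *)

(** Two consecutive values determine the next one and, solving the recurrence for [f (j - 2)], the
    previous one. Induction on pairs therefore runs in both directions from 0 and 1. *)
Lemma fibonacci_recurrence_unique (f g : Z -> R) :
  (forall j, f j = f (j - 1)%Z + f (j - 2)%Z) ->
  (forall j, g j = g (j - 1)%Z + g (j - 2)%Z) ->
  f 0%Z = g 0%Z -> f 1%Z = g 1%Z -> forall j, f j = g j.
Proof.
  intros Hf Hg E0 E1.
  assert (Hpos : forall n : nat,
    f (Z.of_nat n) = g (Z.of_nat n) /\ f (Z.of_nat n + 1)%Z = g (Z.of_nat n + 1)%Z).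
  { induction n as [|n [I0 I1]]; [now split|].
    replace (Z.of_nat (S n)) with (Z.of_nat n + 1)%Z by lia.
    split; [assumption|].
    rewrite Hf, Hg.
    replace (Z.of_nat n + 1 + 1 - 1)%Z with (Z.of_nat n + 1)%Z by lia.
    replace (Z.of_nat n + 1 + 1 - 2)%Z with (Z.of_nat n) by lia.
    now rewrite I0, I1. }
  assert (Hneg : forall n : nat,
    f (- Z.of_nat n)%Z = g (- Z.of_nat n)%Z /\
    f (- Z.of_nat n + 1)%Z = g (- Z.of_nat n + 1)%Z).
  { induction n as [|n [I0 I1]]; [now split|].
    replace (- Z.of_nat (S n) + 1)%Z with (- Z.of_nat n)%Z by lia.
    split; [|assumption].
    pose proof (Hf (- Z.of_nat n + 1)%Z) as F; pose proof (Hg (- Z.of_nat n + 1)%Z) as G.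
    replace (- Z.of_nat n + 1 - 1)%Z with (- Z.of_nat n)%Z in F, G by lia.
    replace (- Z.of_nat n + 1 - 2)%Z with (- Z.of_nat (S n))%Z in F, G by lia.
    lra. }
  intros j; destruct (Z_le_gt_dec 0 j) as [Hj|Hj].
  - rewrite <- (Z2Nat.id j Hj); apply Hpos.
  - replace j with (- Z.of_nat (Z.to_nat (- j)))%Z by lia; apply Hneg.
Qed.

Definition alpha : R := (1 + sqrt 5) / 2.
Definition beta : R := (1 - sqrt 5) / 2.

Lemma sqrt5_pos : 0 < sqrt 5.
Proof. apply sqrt_lt_R0; lra. Qed.

Lemma sqrt5_sqr : sqrt 5 * sqrt 5 = 5.
Proof. apply sqrt_sqrt; lra. Qed.

Lemma alpha_pos : 0 < alpha.
Proof. pose proof sqrt5_pos; unfold alpha; lra. Qed.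

Lemma alpha_neq_0 : alpha <> 0.
Proof. apply Rgt_not_eq, alpha_pos. Qed.

Lemma alpha_mul_beta : alpha * beta = -1.
Proof. pose proof sqrt5_sqr; unfold alpha, beta; nra. Qed.

Lemma beta_neq_0 : beta <> 0.
Proof. pose proof alpha_mul_beta; intros E; rewrite E in *; lra. Qed.

Lemma alpha_sqr : alpha * alpha = alpha + 1.
Proof. pose proof sqrt5_sqr; unfold alpha; nra. Qed.

Lemma beta_sqr : beta * beta = beta + 1.
Proof. pose proof sqrt5_sqr; unfold beta; nra. Qed.

Lemma powerRZ_fibonacci_rec (x : R) (j : Z) : x <> 0 -> x * x = x + 1 ->
  powerRZ x j = powerRZ x (j - 1) + powerRZ x (j - 2).
Proof.
  intros Hx E.
  replace (powerRZ x j) with (powerRZ x (j - 2) * (x * x)).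
  2: { replace j with (j - 2 + 2)%Z at 2 by lia.
       rewrite powerRZ_add by assumption; simpl; ring. }
  replace (j - 1)%Z with (j - 2 + 1)%Z by lia.
  rewrite powerRZ_add, powerRZ_1, E by assumption; ring.
Qed.

Lemma binet_fib (j : Z) :
  IZR (fib j) = (powerRZ alpha j - powerRZ beta j) / sqrt 5.
Proof.
  pose proof sqrt5_pos.
  revert j; apply fibonacci_recurrence_unique.
  - intros j; rewrite (fib_rec j), plus_IZR; reflexivity.
  - intros j.
    rewrite (powerRZ_fibonacci_rec alpha j), (powerRZ_fibonacci_rec beta j);
      auto using alpha_sqr, beta_sqr, alpha_neq_0, beta_neq_0.
    field; lra.
  - simpl; field; lra.
  - rewrite !powerRZ_1; unfold alpha, beta; simpl; field; lra.
Qed.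

Lemma binet_lucas (j : Z) : IZR (lucas j) = powerRZ alpha j + powerRZ beta j.
Proof.
  revert j; apply fibonacci_recurrence_unique.
  - intros j; rewrite (lucas_rec j), plus_IZR; reflexivity.
  - intros j.
    rewrite (powerRZ_fibonacci_rec alpha j), (powerRZ_fibonacci_rec beta j);
      auto using alpha_sqr, beta_sqr, alpha_neq_0, beta_neq_0.
    ring.
  - simpl; ring.
  - rewrite !powerRZ_1; unfold alpha, beta; simpl; field.
Qed.

(** Since [alpha * beta = -1], the product of the two powers is an even power of -1, that is 1. *)
Lemma powerRZ_beta_even (r : Z) :
  powerRZ beta (2 * r) = / powerRZ alpha (2 * r).
Proof.
  pose proof alpha_pos.
  apply Rmult_eq_reg_l with (powerRZ alpha (2 * r));
    [|apply powerRZ_NOR; lra].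
  rewrite Rinv_r by (apply powerRZ_NOR; lra).
  rewrite <- powerRZ_mult, alpha_mul_beta.
  replace (2 * r)%Z with (r + r)%Z by lia.
  rewrite powerRZ_add, <- powerRZ_mult by lra.
  replace (-1 * -1) with 1 by ring; apply powerRZ_R1.
Qed.

Lemma powerRZ_mul_nat_add (x : R) (k s : Z) (j : nat) : x <> 0 ->
  powerRZ x (k * Z.of_nat j + s) = powerRZ x k ^ j * powerRZ x s.
Proof.
  intros Hx; induction j as [|j IH].
  - replace (k * Z.of_nat 0 + s)%Z with s by lia; simpl; ring.
  - replace (k * Z.of_nat (S j) + s)%Z with (k + (k * Z.of_nat j + s))%Z by lia.
    rewrite powerRZ_add, IH by assumption; simpl; ring.
Qed.

(** * Combining the arctangent series at [alpha^(2r)] and its inverse *)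

Theorem theorem8 (r s : Z) :
  is_series
    (fun j : nat =>
       2 ^ (2 * j + 1) / INR (2 * j + 1) * (1 / Binomial.C (2 * j) j) *
       (IZR (fib (2 * r * Z.of_nat j + s)) / IZR (lucas (2 * r)) ^ (j + 1)))
    (PI / 2 * IZR (fib s) +
     IZR (lucas s) / sqrt 5 * atan (IZR (fib (2 * r)) * sqrt 5 / 2))
  /\
  is_series
    (fun j : nat =>
       2 ^ (2 * j + 1) / INR (2 * j + 1) * (1 / Binomial.C (2 * j) j) *
       (IZR (lucas (2 * r * Z.of_nat j + s)) / IZR (lucas (2 * r)) ^ (j + 1)))
    (PI / 2 * IZR (lucas s) +
     IZR (fib s) * sqrt 5 * atan (IZR (fib (2 * r)) * sqrt 5 / 2)).
Proof.
  pose proof alpha_pos as Hal; pose proof beta_neq_0 as Hbe; pose proof sqrt5_pos.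
  set (a := powerRZ alpha (2 * r)).
  assert (Ha : 0 < a) by (apply powerRZ_lt, Hal).
  assert (Hb : powerRZ beta (2 * r) = / a) by apply powerRZ_beta_even.
  assert (HL : IZR (lucas (2 * r)) = a + / a) by (rewrite binet_lucas, Hb; reflexivity).
  assert (HF : IZR (fib (2 * r)) * sqrt 5 / 2 = (a - / a) / 2).
  { rewrite binet_fib, Hb; fold a; field; lra. }
  pose proof (is_series_euler_atan_symmetric a Ha) as SA.
  pose proof (is_series_euler_atan_symmetric (/ a) (Rinv_0_lt_compat a Ha)) as SB.
  rewrite Rinv_inv, (Rplus_comm (/ a) a) in SB.
  rewrite HF, HL, <- atan_minus_atan_inv, (binet_fib s), (binet_lucas s) by assumption.
  (* Replacing [atan (/ a)] by [PI / 2 - atan a] leaves [atan a] as the only arctangent, so each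
     claimed value becomes a field identity. *)
  rewrite atan_inv in SB |- * by assumption.
  split.
  (* The weights come from Binet: [F_(2rj+s)] is [a^j alpha^s / sqrt 5] minus
     [(/ a)^j beta^s / sqrt 5]. *)
  - pose proof (is_series_minus _ _ _ _
      (is_series_scal (powerRZ alpha s / sqrt 5) _ _ SA)
      (is_series_scal (powerRZ beta s / sqrt 5) _ _ SB)) as H0.
    match type of H0 with is_series _ ?l => match goal with |- is_series _ ?l' =>
      replace l' with l end end.
    + revert H0; apply is_series_ext; intros j.
      rewrite binet_fib, !powerRZ_mul_nat_add, Hb by lra; fold a.
      unfold scal, plus, opp; simpl; unfold mult; simpl; unfold Rdiv; ring.
    + unfold scal, plus, opp; simpl; unfold mult; simpl; field; lra.
  (* For Lucas numbers the weights are [alpha^s] and [beta^s], and the two series are added. *)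
  - pose proof (is_series_plus _ _ _ _
      (is_series_scal (powerRZ alpha s) _ _ SA)
      (is_series_scal (powerRZ beta s) _ _ SB)) as H0.
    match type of H0 with is_series _ ?l => match goal with |- is_series _ ?l' =>
      replace l' with l end end.
    + revert H0; apply is_series_ext; intros j.
      rewrite binet_lucas, !powerRZ_mul_nat_add, Hb by lra; fold a.
      unfold scal, plus; simpl; unfold mult; simpl; unfold Rdiv; ring.
    + unfold scal, plus; simpl; unfold mult; simpl; field; lra.
Qed.
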